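(* Let $S(X)=\sum_j a_jX^j$ and $T(X)=\sum_i b_iX^i$ be two power series with coefficients in $\mathbb{K}$. Assume that the convergence domains of both $S(X)$ and $T(X)$ are different from the set $\{0\}$, and that $T(X)$ converges at $a_0$. Define $c_{ij}\in\mathbb{K}$ for $i,j\in\mathbb{N}$ by $c_{00}=1$, $c_{0j}=0$ for all $j\neq 0$, and $c_{i+1,j}=c_{i0}a_j+c_{i1}a_{j-1}+\cdots+c_{ij}a_0$. Then for every $j$ the series $d_j=\sum_i b_ic_{ij}$ converges in $\mathbb{K}$, and there is a neighbourhood $U$ of $0$ in $\mathbb{K}$ such that for every $x\in U$ the value $T(S(x))$ is defined and $$T(S(x))=\sum_j d_jx^j.$$
   Context: $\mathbb{K}$ is a non-Archimedean ordered field (i.e. it contains an element larger than every integer), equipped with its order topology, which is (Cauchy) complete and has a countable basis of neighbourhoods of $0$. $\mathbb{N}=\{0,1,2,\dots\}$; all series are indexed from $0$, and $x^0=1$. A series in $\mathbb{K}$ converges if its sequence of partial sums converges. A power series $\sum_n a_nX^n$ converges at $x\in\mathbb{K}$ if $\sum_n a_nx^n$ converges in $\mathbb{K}$; its convergence domain is the set of all $x\in\mathbb{K}$ at which it converges. ''$T(S(x))$ is defined'' means that $S$ converges at $x$ and $T$ converges at the sum $S(x)$. The $d_j$ are called the expected coefficients of the formal substitution $T(S(X))$. *)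

(* Defs.v *)
From mathcomp Require Import all_boot all_order all_algebra.
From mathcomp Require Import all_classical all_reals all_analysis.

Set Implicit Arguments.
Unset Strict Implicit.
Unset Printing Implicit Defensive.

Import Order.TTheory GRing.Theory Num.Theory.
(* A realFieldType carries here the topology and uniformity of the balls
   {y | `|x - y| < e} with e > 0 in the field itself.  This is the order topology
   (real_order_nbhsE), and the uniformity of the additive group. *)
Import numFieldNormedType.Exports.

Local Open Scope classical_set_scope.
Local Open Scope ring_scope.

Definition non_archimedean (K : realFieldType) : Prop :=
  exists w : K, forall z : int, z%:~R < w.

(* Same condition as the mixin of completeType. *)
Definition cauchy_complete (T : puniformType) : Prop :=
  forall F : set_system T, ProperFilter F -> cauchy F -> cvg F.

Definition countable_nbhs_basis (T : topologicalType) (x : T) : Prop :=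
  exists B : set_system T, [/\ countable B,
    B `<=` nbhs x &
    forall U, nbhs x U -> exists2 V, B V & V `<=` U].

(* The library's pseries is restricted to a realType. *)
Definition power_series (K : realFieldType) (a : K^nat) (x : K) : K^nat :=
  series (fun n => a n * x ^+ n).

Definition convergence_domain (K : realFieldType) (a : K^nat) : set K :=
  [set x | cvgn (power_series a x)].

Definition power_series_sum (K : realFieldType) (a : K^nat) (x : K) : K :=
  limn (power_series a x).

Fixpoint subst_coef (K : realFieldType) (a : K^nat) (i j : nat) : K :=
  if i is i'.+1 then \sum_(k < j.+1) subst_coef a i' k * a (j - k)%N
  else (j == 0%N)%:R.

Definition expected_series (K : realFieldType) (a b : K^nat) (j : nat) : K^nat :=
  series (fun i => b i * subst_coef a i j).

Definition expected_coef (K : realFieldType) (a b : K^nat) (j : nat) : K :=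
  limn (expected_series a b j).

(* Main.v *)
(* If w exceeds every natural number, a finite sum of terms of size at most e has
   size at most w * e, whatever the number of terms; so a series converges as soon
   as its terms tend to 0.  Let rho be the larger of |a_0| and |y|, where y is a
   nonzero point at which T converges, so that b_i rho^i tends to 0.  For x small
   enough, |a_j x^j| <= rho for all j, so |c_ij x^j| <= (j + 1)^i rho^i <= w rho^i.
   Hence b_i c_ij x^j tends to 0 as i grows, uniformly in j, and the double series
   can be summed in either order. *)
Require Import Defs.
From mathcomp Require Import all_boot all_order all_algebra.
From mathcomp Require Import all_classical all_reals all_analysis.
From mathcomp Require Import ring.

Set Implicit Arguments.
Unset Strict Implicit.
Unset Printing Implicit Defensive.

Import Order.TTheory GRing.Theory Num.Theory.
Import numFieldNormedType.Exports.

Local Open Scope classical_set_scope.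
Local Open Scope ring_scope.

(** * Series over a field with an element [w] above every natural number *)

Section InfiniteElement.
Context (K : realFieldType) (w : K).
Hypothesis w_infinite : forall n : nat, n%:R < w.

Let w_gt0 : 0 < w. Proof. exact: w_infinite 0%N. Qed.

Lemma ler_norm_sum_infinite (t : K^nat) (e : K) (m n : nat) : 0 <= e ->
  (forall i, (m <= i < n)%N -> `|t i| <= e) ->
  `|\sum_(m <= i < n) t i| <= w * e.
Proof.
move=> e0 te; apply: (le_trans (ler_norm_sum _ _ _)).
rewrite big_nat_cond; apply: (@le_trans _ _ (\sum_(m <= i < n) e)).
  rewrite [leRHS]big_nat_cond; apply: ler_sum => i; rewrite andbT; exact: te.
by rewrite sumr_const_nat -mulr_natl ler_wpM2r// ltW.
Qed.

(** The bound on finite blocks does not depend on their length, so it passes to the limit of the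
    partial sums. *)
Lemma cvg_series_tail_le (t : K^nat) (e s : K) (n : nat) : 0 <= e ->
  (forall i, (n <= i)%N -> `|t i| <= e) -> series t @ \oo --> s ->
  `|s - series t n| <= w * e.
Proof.
move=> e0 te ts.
have nts : `|series t m - series t n| @[m --> \oo] --> `|s - series t n|.
  by apply: cvg_norm; apply: cvgB => //; apply: cvg_cst.
apply: (cvgr_to_le nts); near=> m.
rewrite sub_series_geq; last by near: m; exact: nbhs_infty_ge.
by apply: ler_norm_sum_infinite => // i /andP[ni _]; exact: te.
Unshelve. all: by end_near. Qed.

Lemma cvg_series_norm_le (t : K^nat) (e s : K) : 0 <= e ->
  (forall i, `|t i| <= e) -> series t @ \oo --> s -> `|s| <= w * e.
Proof.
move=> e0 te ts; have := @cvg_series_tail_le t e s 0 e0 (fun i _ => te i) ts.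
by rewrite /series /= big_geq// subr0.
Qed.

Lemma cvg0_cvg_series (t : K^nat) : cauchy_complete K ->
  t @ \oo --> 0 -> cvgn (series t).
Proof.
move=> K_complete /cvgr0Pnorm_le t0.
apply: K_complete; apply/cauchy_seriesP => e e0.
(* The factor 2 turns the weak bound on blocks into the strict one of the Cauchy criterion. *)
have [|N _ tN] := t0 (e / (2 * w)); first by rewrite divr_gt0// mulr_gt0.
exists ([set n | (N <= n)%N], [set n | (N <= n)%N]).
  by split; exists N.
move=> [m n] /= [Nm _]; apply: (@le_lt_trans _ _ (w * (e / (2 * w)))).
  apply: ler_norm_sum_infinite => [|i /andP[mi _]].
    by rewrite ltW// divr_gt0// mulr_gt0.
  by apply: tN; exact: leq_trans mi.
have -> : w * (e / (2 * w)) = e / 2 by field; rewrite gt_eqF.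
by rewrite ltr_pdivrMr// mulr_natr mulr2n ltrDl.
Qed.

(* Only finitely many |u i j| exceed a given d > 0: uniformity handles all rows but
   finitely many, and each remaining row tends to 0. *)
Lemma cvg_series_exchange (u : nat -> nat -> K) (r c : K^nat) (s : K) :
  (forall e, 0 < e -> \forall i \near \oo, forall j, `|u i j| <= e) ->
  (forall i, series (u i) @ \oo --> r i) ->
  (forall j, series (u^~ j) @ \oo --> c j) ->
  series r @ \oo --> s -> series c @ \oo --> s.
Proof.
move=> u_unif ur uc rs; apply/cvgrPdist_le => e e0.
(* One factor [w] pays for an inner sum, the other for an outer sum, and 3 counts the error terms
   [rows], [columns] and [tail]. *)
pose d := e / (3 * w * w).
have d0 : 0 < d by rewrite divr_gt0// !mulr_gt0.
have dE : w * (w * d) = e / 3.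
  by rewrite /d; field; rewrite gt_eqF.
have wd0 : 0 <= w * d by rewrite mulr_ge0// ltW.
have [N _ uN] := u_unif d d0.
have [M uM] : exists M, forall j i, (M <= j)%N -> `|u i j| <= d.
  suff [M uM] : exists M, forall j i, (M <= j)%N -> (i < N)%N -> `|u i j| <= d.
    exists M => j i Mj; have [|Ni] := ltnP i N; first exact: uM.
    exact: uN.
  elim: N {uN} => [|N [M uM]]; first by exists 0%N.
  have /cvgr0Pnorm_le/(_ _ d0)[M' _ uM'] : u N @ \oo --> 0.
    by apply: cvg_series_cvg_0; apply/cvg_ex; exists (r N).
  exists (maxn M M') => j i; rewrite geq_max => /andP[Mj M'j].
  by rewrite ltnS leq_eqVlt => /predU1P[->|]; [exact: uM'|exact: uM].
exists M => // m /= Mm.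
have rows : `|\sum_(0 <= i < N) (r i - series (u i) m)| <= w * (w * d).
  apply: ler_norm_sum_infinite => // i _.
  apply: cvg_series_tail_le => //; first exact: ltW.
  by move=> j mj; apply: uM; exact: leq_trans mj.
have columns : `|\sum_(0 <= j < m) (c j - series (u^~ j) N)| <= w * (w * d).
  apply: ler_norm_sum_infinite => // j _.
  apply: cvg_series_tail_le => //; first exact: ltW.
  by move=> i Ni; apply: uN.
have tail : `|s - series r N| <= w * (w * d).
  apply: cvg_series_tail_le => // i Ni.
  by apply: (cvg_series_norm_le _ _ (ur i)) => [|j]; [exact: ltW|exact: uN].
(* The block of the first [N] rows and [m] columns has the same sum by rows and by columns, so it
   cancels. *)
have -> : s - series c m = (s - series r N)
    + \sum_(0 <= i < N) (r i - series (u i) m)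
    - \sum_(0 <= j < m) (c j - series (u^~ j) N).
  rewrite !sumrB /series /= exchange_big_nat /=.
  by ring.
have -> : e = e / 3 + e / 3 + e / 3 by field.
rewrite -dE; apply: (le_trans (ler_normB _ _)); apply: lerD => //.
by apply: (le_trans (ler_normD _ _)); exact: lerD.
Qed.

(** * Cauchy products *)

(** Absolute convergence is not assumed: summing a suitable array by rows and by columns gives both
    sides. *)
Lemma cvg_series_Cauchy_product (p q : K^nat) (s t : K) :
  series p @ \oo --> s -> series q @ \oo --> t ->
  series (fun j => \sum_(k < j.+1) p k * q (j - k)%N) @ \oo --> s * t.
Proof.
move=> ps qt.
have p0 : p @ \oo --> 0.
  by apply: cvg_series_cvg_0; apply/cvg_ex; exists s.
have [M M0 qM] : exists2 M, 0 < M & forall j, `|q j| <= M.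
  have [M [_ qM]] : bounded_fun q.
    by apply: cvg_series_bounded; apply/cvg_ex; exists t.
  (* Boundedness gives the estimate for every number strictly above [M]; this one is also positive,
     so it can be a divisor. *)
  exists (`|M| + 1) => [|j]; first by rewrite ltr_wpDl.
  by apply: qM => //; rewrite (le_lt_trans (ler_norm M))// ltrDl.
(* Row k of u is q shifted by k and scaled by p k; column j is the jth term of the
   product. *)
pose u k j := if (k <= j)%N then p k * q (j - k)%N else 0.
apply: (@cvg_series_exchange u (fun k => p k * t)).
- move=> e e0; have /cvgr0Pnorm_le/(_ (e / M)) := p0.
  move=> /(_ (divr_gt0 e0 M0)); apply: filterS => k pk j.
  rewrite /u; case: ifP => _; last by rewrite normr0 ltW.
  rewrite normrM -(divfK (lt0r_neq0 M0) e).
  by rewrite ler_pM.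
(* Row [k] starts with [k] zeros; after a shift by [k] its partial sums are [p k] times those of
   [q]. *)
- move=> k; rewrite -(cvg_shiftn k).
  have -> : (fun n => series (u k) (n + k)%N) = (fun n => p k * series q n).
    apply/funext => n; rewrite /series /= addnC.
    rewrite (@big_cat_nat _ _ _ k)//= ?leq_addr//.
    rewrite big_nat_cond big1 ?add0r; last first.
      by move=> i; rewrite andbT /u => /andP[_]; rewrite ltnNge => /negbTE ->.
    rewrite -[X in \sum_(X <= _ < _) _]add0n big_addn addKn mulr_sumr.
    by apply: eq_bigr => i _; rewrite /u leq_addl addnK.
  exact: cvgMl_tmp.
(* Column [j] vanishes below row [j], so its partial sums are constant from [j.+1] on. *)
- move=> j; apply: cvg_near_cst; exists j.+1 => // n /= jn.
  rewrite /series /= (@big_cat_nat _ _ _ j.+1)//= [X in _ + X]big_nat_cond.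
  rewrite [X in _ + X]big1 ?addr0; last first.
    by move=> i; rewrite andbT /u => /andP[+ _]; rewrite ltnNge => /negbTE ->.
  rewrite big_mkord; apply: eq_bigr => i _.
  by rewrite /u -ltnS ltn_ord.
- have -> : series (fun k => p k * t) = (fun n => series p n * t).
    by apply/funext => n; rewrite /series /= mulr_suml.
  exact: cvgMr_tmp.
Qed.

(** * Coefficients of the powers of the inner series, and the substitution *)

(** Each of the [i] steps of the recursion adds at most [j.+1] products, and [x ^+ j] splits between
    the two factors of each product. *)
Lemma subst_coef_norm_le (a : K^nat) (x rho : K) (i j : nat) : 0 <= rho ->
  (forall k, `|a k * x ^+ k| <= rho) ->
  `|subst_coef a i j * x ^+ j| <= (j.+1)%:R ^+ i * rho ^+ i.
Proof.
move=> rho0 arho; elim: i j => [|i IH] j /=.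
  rewrite !expr0 mulr1; case: j => [|j]; first by rewrite mulr1 normr1.
  by rewrite mul0r normr0 ler01.
rewrite mulr_suml; apply: (le_trans (ler_norm_sum _ _ _)).
apply: (@le_trans _ _ (\sum_(k < j.+1) (j.+1%:R ^+ i * rho ^+ i * rho))).
  apply: ler_sum => k _.
  have kj : (k <= j)%N by rewrite -ltnS.
  have -> : subst_coef a i k * a (j - k)%N * x ^+ j =
      (subst_coef a i k * x ^+ k) * (a (j - k)%N * x ^+ (j - k)).
    have -> : x ^+ j = x ^+ k * x ^+ (j - k) by rewrite -exprD subnKC.
    by ring.
  rewrite normrM; apply: ler_pM => //; apply: (le_trans (IH k)).
  by rewrite ler_wpM2r ?exprn_ge0// lerXn2r ?nnegrE// ler_nat ltnS.
rewrite sumr_const card_ord -mulr_natl !exprS le_eqVlt; apply/orP; left.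
by apply/eqP; ring.
Qed.

(** Row [i] of [subst_coef] holds the coefficients of the formal [i]-th power of the series, built
    by iterated Cauchy products. *)
Lemma cvg_subst_coef (a : K^nat) (x s : K) (i : nat) :
  power_series a x @ \oo --> s ->
  series (fun j => subst_coef a i j * x ^+ j) @ \oo --> s ^+ i.
Proof.
move=> axs; elim: i => [|i IH].
  apply: cvg_near_cst; exists 1%N => // -[//|n] _.
  rewrite /series /= big_mkord big_ord_recl big1 ?addr0 /= ?mulr1//.
  by move=> k _; rewrite mul0r.
rewrite exprSr; suff -> : (fun j => subst_coef a i.+1 j * x ^+ j) =
    (fun j => \sum_(k < j.+1)
      subst_coef a i k * x ^+ k * (a (j - k)%N * x ^+ (j - k))).
  exact: cvg_series_Cauchy_product IH axs.
apply/funext => j; rewrite /= mulr_suml; apply: eq_bigr => k _.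
have kj : (k <= j)%N by rewrite -ltnS.
have -> : x ^+ j = x ^+ k * x ^+ (j - k) by rewrite -exprD subnKC.
by ring.
Qed.

(** The factor [j.+1 ^ i] is a natural number, hence below [w] for all [i] and [j]; this removes the
    dependence on [j]. *)
Lemma subst_term_uniform_cvg0 (a b : K^nat) (x rho : K) : 0 <= rho ->
  (forall k, `|a k * x ^+ k| <= rho) -> b i * rho ^+ i @[i --> \oo] --> 0 ->
  forall e, 0 < e -> \forall i \near \oo, forall j,
    `|b i * subst_coef a i j * x ^+ j| <= e.
Proof.
move=> rho0 arho /cvgr0Pnorm_le brho e e0.
have ew0 : 0 < e / w by rewrite divr_gt0.
apply: filterS (brho _ ew0) => i bi j; rewrite -mulrA normrM.
apply: (@le_trans _ _ (`|b i| * (w * rho ^+ i))).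
  apply: ler_wpM2l => //; apply: (le_trans (subst_coef_norm_le i j rho0 arho)).
  by rewrite ler_wpM2r ?exprn_ge0// -natrX ltW.
rewrite [w * _]mulrC mulrA -ler_pdivlMr//.
by rewrite -(ger0_norm (exprn_ge0 i rho0)) -normrM.
Qed.

(** The terms multiplied by [x ^+ j] tend to 0, and for a nonzero [x] this constant factor can be
    divided out. *)
Lemma expected_series_cvg (a b : K^nat) (x rho : K) (j : nat) :
  cauchy_complete K -> x != 0 -> 0 <= rho ->
  (forall k, `|a k * x ^+ k| <= rho) -> b i * rho ^+ i @[i --> \oo] --> 0 ->
  cvgn (expected_series a b j).
Proof.
move=> K_complete x0 rho0 arho brho; apply: cvg0_cvg_series => //.
have xj0 : x ^+ j != 0 by rewrite expf_neq0.
have -> : (fun i => b i * subst_coef a i j) =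
    (fun i => b i * subst_coef a i j * x ^+ j * (x ^+ j)^-1).
  by apply/funext => i; rewrite mulfK.
rewrite -(mul0r (x ^+ j)^-1); apply: cvgMr_tmp; apply/cvgr0Pnorm_le => e e0.
have := subst_term_uniform_cvg0 rho0 arho brho e0.
by apply: filterS => i; apply.
Qed.

Lemma cvg_power_series_subst (a b : K^nat) (x rho s : K) :
  cauchy_complete K ->
  (forall j, cvgn (expected_series a b j)) -> 0 <= rho ->
  (forall k, `|a k * x ^+ k| <= rho) -> b i * rho ^+ i @[i --> \oo] --> 0 ->
  power_series a x @ \oo --> s ->
  exists2 y : K, power_series b s @ \oo --> y &
    power_series (expected_coef a b) x @ \oo --> y.
Proof.
move=> K_complete d_cvg rho0 arho brho axs.
have u_unif := subst_term_uniform_cvg0 rho0 arho brho.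
pose u i j := b i * subst_coef a i j * x ^+ j.
have rows i : series (u i) @ \oo --> b i * s ^+ i.
  have -> : series (u i) =
      (fun n => b i * series (fun j => subst_coef a i j * x ^+ j) n).
    apply/funext => n; rewrite /series /= mulr_sumr.
    by apply: eq_bigr => j _; rewrite /u mulrA.
  by apply: cvgMl_tmp; exact: cvg_subst_coef.
have columns j : series (u^~ j) @ \oo --> expected_coef a b j * x ^+ j.
  have -> : series (u^~ j) = (fun n => expected_series a b j n * x ^+ j).
    by apply/funext => n; rewrite /expected_series /series /= mulr_suml.
  by apply: cvgMr_tmp; exact: d_cvg.
(* Each [b i * s ^+ i] is the sum of row [i], so it is at most [w] times a bound on the entries of
   that row. *)
have b_cvg : cvgn (power_series b s).
  apply: cvg0_cvg_series => //; apply/cvgr0Pnorm_le => e e0.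
  have := u_unif _ (divr_gt0 e0 w_gt0); apply: filterS => i ui.
  have -> : e = w * (e / w) by field; rewrite gt_eqF.
  by apply: (cvg_series_norm_le _ _ (rows i)) => //; rewrite ltW// divr_gt0.
exists (limn (power_series b s)) => //.
exact: (cvg_series_exchange u_unif rows columns).
Qed.

End InfiniteElement.

(** * Convergence domains and the choice of the neighbourhood *)

(** Every power series converges at 0, so a domain other than [[set 0]] must have a further
    point. *)
Lemma convergence_domain_neq0 (K : realFieldType) (a : K^nat) :
  convergence_domain a <> [set 0] ->
  exists2 x, x != 0 & convergence_domain a x.
Proof.
move=> a_dom; apply: contrapT => no_x; apply: a_dom.
rewrite eqEsubset; split => [x ax|_ ->] /=.
  by apply: contrapT => /eqP x0; apply: no_x; exists x.
apply/cvg_ex; exists (a 0%N); apply: cvg_near_cst.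
exists 1%N => // -[//|n] _; rewrite /power_series /series /= big_mkord.
rewrite big_ord_recl big1 ?addr0 ?mulr1// => i _.
by rewrite expr0n mulr0.
Qed.

Lemma convergence_domain_cvg0_norm (K : realFieldType) (b : K^nat) (x : K) :
  convergence_domain b x -> b i * `|x| ^+ i @[i --> \oo] --> 0.
Proof.
move=> /cvg_series_cvg_0/cvgr0Pnorm_le bx0; apply/cvgr0Pnorm_le => e e0.
by apply: filterS (bx0 e e0) => i; rewrite !normrM !normrX normr_id.
Qed.

Theorem theorem6p6 (K : realFieldType)
    (K_non_archimedean : non_archimedean K)
    (K_complete : cauchy_complete K)
    (K_countable_basis : countable_nbhs_basis (0 : K))
    (a b : nat -> K)
    (S_domain : convergence_domain a <> [set 0])
    (T_domain : convergence_domain b <> [set 0])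
    (T_cvg_a0 : convergence_domain b (a 0%N)) :
  (forall j : nat, cvgn (expected_series a b j)) /\
  exists2 U : set K, nbhs (0 : K) U &
    forall x : K, U x ->
      [/\ convergence_domain a x,
          convergence_domain b (power_series_sum a x),
          convergence_domain (expected_coef a b) x &
          power_series_sum b (power_series_sum a x) =
            power_series_sum (expected_coef a b) x].
Proof.
have [w w_gt] := K_non_archimedean.
have w_infinite (n : nat) : n%:R < w by exact: w_gt n%:Z.
have [y y0 by_cvg] := convergence_domain_neq0 T_domain.
have [r r0 ar_cvg] := convergence_domain_neq0 S_domain.
(* Whichever norm is larger, it comes from a point where [b] converges; [y] being nonzero makes
   [rho] positive. *)
pose rho := Num.max `|a 0%N| `|y|.
have rho0 : 0 < rho by rewrite lt_max [X in _ || X]normr_gt0 y0 orbT.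
have brho : b i * rho ^+ i @[i --> \oo] --> 0.
  by rewrite /rho /Num.max; case: ifP => _; exact: convergence_domain_cvg0_norm.
have [M M0 arM] : exists2 M, 0 < M & forall j, `|a j * r ^+ j| <= M.
  have [M [_ arM]] := cvg_series_bounded ar_cvg.
  exists (`|M| + 1) => [|j]; first by rewrite ltr_wpDl.
  by apply: arM => //; rewrite (le_lt_trans (ler_norm M))// ltrDl.
(* This makes [x / r] at most 1 and at most [rho / M] in norm when [x] is at most [delta] in
   norm. *)
pose delta := `|r| * Num.min 1 (rho / M).
have delta0 : 0 < delta.
  by rewrite mulr_gt0 ?normr_gt0// lt_min ltr01 divr_gt0.
have quotient x : `|x| <= delta -> `|x / r| <= 1 /\ `|x / r| <= rho / M.
  move=> xd; apply/andP; rewrite -le_min normrM normfV.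
  by rewrite ler_pdivrMr ?normr_gt0// mulrC.
have termE x j : a j * x ^+ j = a j * r ^+ j * (x / r) ^+ j.
  by rewrite expr_div_n mulrAC -mulrA divfK// expf_neq0.
(* The constant term is bounded by the choice of [rho]. For positive [j], one factor [x / r] turns
   [M] into [rho] and the others are at most 1. *)
have arho x : `|x| <= delta -> forall j, `|a j * x ^+ j| <= rho.
  move=> /quotient[q1 qrho] [|j]; first by rewrite mulr1 le_max lexx.
  rewrite termE normrM -(divfK (lt0r_neq0 M0) rho) mulrC.
  apply: ler_pM => //; rewrite normrX exprS.
  by apply: le_trans qrho; rewrite ler_piMr// exprn_ile1.
have d_cvg j : cvgn (expected_series a b j).
  (* The radius itself serves as the nonzero point. *)
  have xd : `|delta| <= delta by rewrite gtr0_norm.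
  exact: (expected_series_cvg w_infinite K_complete (lt0r_neq0 delta0)
    (ltW rho0) (arho _ xd) brho).
split=> //; exists [set x | `|x| <= delta].
  apply/nbhs_normP; exists delta => //= x; rewrite /= sub0r normrN; exact: ltW.
move=> x /= xd.
(* The terms at [x] are dominated by those at [r], which tend to 0. *)
have a_cvg : cvgn (power_series a x).
  apply: (cvg0_cvg_series w_infinite) => //.
  have /cvgr0Pnorm_le ar0 := cvg_series_cvg_0 ar_cvg.
  apply/cvgr0Pnorm_le => e e0; apply: filterS (ar0 e e0) => j; apply: le_trans.
  have [q1 _] := quotient x xd.
  by rewrite termE normrM ler_piMr// normrX exprn_ile1.
have [z bz dz] := cvg_power_series_subst w_infinite K_complete d_cvg
  (ltW rho0) (arho x xd) brho a_cvg.
split=> //; [by apply/cvg_ex; exists z|by apply/cvg_ex; exists z|].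
rewrite /power_series_sum.
have -> := cvg_lim (@norm_hausdorff _ _) bz.
by have -> := cvg_lim (@norm_hausdorff _ _) dz.
Qed.
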